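(* For every integer $t\geq 8$ the following holds. For arbitrarily small $\epsilon>0$ there exists a graph property $\Pi=\Pi_\epsilon$ (which depends on $\epsilon$) such that, if $q$ denotes the adaptive query complexity and $Q$ the non-adaptive query complexity of $\epsilon$-testing $\Pi$ in the dense-graph model, then $q=\tilde{\Theta}(\epsilon^{-1})$ and $Q=\tilde{\Theta}(q^{2-2/t})$.
   Context: Dense-graph model: an algorithm receives $N$ and $\epsilon$ and accesses an undirected graph $G=([N],E)$ only through an oracle $g:[N]\times[N]\to\{0,1\}$ with $g(u,v)=1$ iff $(u,v)\in E$; each oracle call is a query. A graph is $\epsilon$-far from a property (set of graphs closed under isomorphism) $\Pi$ if at least $\epsilon N^2$ edges must be added or deleted to obtain a graph in $\Pi$, and $\epsilon$-close otherwise. A randomized algorithm is an $\epsilon$-tester for $\Pi$ if it accepts every $G\in\Pi$ with probability $>2/3$ and rejects every $G$ that is $\epsilon$-far from $\Pi$ with probability $>2/3$. A tester is adaptive if each query may depend on answers to previous queries, and non-adaptive if all queries are fixed in advance (depending only on internal randomness). The (adaptive, resp. non-adaptive) query complexity is the minimum, over all (adaptive, resp. non-adaptive) $\epsilon$-testers, of the maximal number of queries made, as a function of $\epsilon$. The notation $\tilde{\Theta}$ hides factors polylogarithmic in $1/\epsilon$ and constants depending on $t$, with asymptotics as $\epsilon\to 0$. *)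

(* Defs.v *)
From Stdlib Require List.
From HB Require Import structures.
From mathcomp Require Import all_boot all_order all_algebra all_fingroup.
From mathcomp Require Import all_classical all_reals all_analysis.
Set Implicit Arguments. Unset Strict Implicit. Unset Printing Implicit Defensive.
Import Order.TTheory GRing.Theory Num.Theory.
Local Open Scope ring_scope.

Record graph (N : nat) := Graph {
  adj : rel 'I_N;
  adj_sym : symmetric adj;
  adj_irr : irreflexive adj }.

Definition graph_property := forall N : nat, graph N -> Prop.

Definition iso_closed (P : graph_property) : Prop :=
  forall N (G H : graph N) (s : {perm 'I_N}),
    (forall u v, adj H (s u) (s v) = adj G u v) -> P N G -> P N H.

Definition gdist N (G H : graph N) : nat :=
  #|[set p : 'I_N * 'I_N | (p.1 < p.2)%N && (adj G p.1 p.2 != adj H p.1 p.2)]|.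

Section Testing.
Variable R : realType.

Definition eps_far (P : graph_property) (eps : R) N (G : graph N) : Prop :=
  forall H : graph N, P N H -> eps * (N ^ 2)%:R <= (gdist G H)%:R.

Inductive dtree (N : nat) : Type :=
| Leaf of bool
| Node of 'I_N & 'I_N & dtree N & dtree N.

Fixpoint dt_run N (t : dtree N) (g : rel 'I_N) : bool :=
  match t with
  | Leaf b => b
  | Node u v t0 t1 => if g u v then dt_run t1 g else dt_run t0 g
  end.

Fixpoint dt_cost N (t : dtree N) (g : rel 'I_N) : nat :=
  match t with
  | Leaf _ => 0
  | Node u v t0 t1 => (if g u v then dt_cost t1 g else dt_cost t0 g).+1
  end.

Record natest (N : nat) := NATest {
  na_queries : seq ('I_N * 'I_N);
  na_decide : seq bool -> bool }.

Definition na_run N (A : natest N) (g : rel 'I_N) : bool :=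
  na_decide A [seq g p.1 p.2 | p <- na_queries A].

Definition na_cost N (A : natest N) : nat := size (na_queries A).

Definition is_distr (A : Type) (D : seq (R * A)) : Prop :=
  (forall x, Stdlib.Lists.List.In x D -> 0 <= x.1) /\ \sum_(x <- D) x.1 = 1.

Definition acc_prob (A : Type) (run : A -> bool) (D : seq (R * A)) : R :=
  \sum_(x <- D) x.1 * (run x.2)%:R.

Definition tester_ok (P : graph_property) (eps : R)
  (accP : forall N, graph N -> R) : Prop :=
  (forall N (G : graph N), P N G -> accP N G > 2%:R / 3%:R) /\
  (forall N (G : graph N), eps_far P eps G -> 1 - accP N G > 2%:R / 3%:R).

Definition adaptive_tester (P : graph_property) (eps : R) (k : nat) : Prop :=
  exists T : forall N, seq (R * dtree N),
    (forall N, is_distr (T N)) /\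
    (forall N (G : graph N) x, Stdlib.Lists.List.In x (T N) -> (dt_cost x.2 (adj G) <= k)%N) /\
    tester_ok P eps (fun N G => acc_prob (fun t => dt_run t (adj G)) (T N)).

Definition nonadaptive_tester (P : graph_property) (eps : R) (k : nat) : Prop :=
  exists T : forall N, seq (R * natest N),
    (forall N, is_distr (T N)) /\
    (forall N x, Stdlib.Lists.List.In x (T N) -> (na_cost x.2 <= k)%N) /\
    tester_ok P eps (fun N G => acc_prob (fun A => na_run A (adj G)) (T N)).

Definition adaptive_qc (P : graph_property) (eps : R) (q : nat) : Prop :=
  adaptive_tester P eps q /\ forall k, adaptive_tester P eps k -> (q <= k)%N.

Definition nonadaptive_qc (P : graph_property) (eps : R) (q : nat) : Prop :=
  nonadaptive_tester P eps q /\ forall k, nonadaptive_tester P eps k -> (q <= k)%N.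

Definition logfac (eps : R) : R := 1 + ln (1 + eps^-1).

End Testing.

(* Main.v *)
(** The property only constrains graphs on one number N of vertices: no connected component may have exactly L vertices. The component of a vertex can be explored with L N adaptive queries, and isolating all vertices of bad components costs at most L edits per such vertex, so a far graph has many bad vertices and sampling starting points gives a tester. Distinguishing the empty graph from a few randomly placed components of size L yields the matching adaptive lower bound.

For the non-adaptive lower bound, take blocks that are double covers of a cycle of logarithmic length: a block is one component of size L if the parity of its crossings is odd, and splits into two components of size L/2 if it is even. The columns of the blocks are shifted independently, so that a fixed set of much fewer than N^2 queries misses, in each block, all the pairs at some rung; flipping the crossing there exchanges even and odd covers without changing any answer.

With w = 2^r, L of order r t, N = L w^(t-1) and eps = w^(-t), the adaptive complexity is about w^t and the non-adaptive one about N^2, that is w^(2t-2), up to powers of L. *)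
Require Import Defs.
From HB Require Import structures.
From mathcomp Require Import all_boot all_order all_algebra all_fingroup.
From mathcomp Require Import all_classical all_reals all_analysis.
From mathcomp Require Import zify ring lra.
Import Order.TTheory GRing.Theory Num.Theory.
Local Open Scope ring_scope.
Set Implicit Arguments. Unset Strict Implicit. Unset Printing Implicit Defensive.

(** * Component sizes and edit distance *)

(** Agreement is assumed only on the component of [v] for [e], but this also controls paths of [e']:
    followed from [v], such a path consists of edges of [e] and never leaves that component. *)
Lemma connect_eq_rows (T : finType) (e e' : rel T) (v : T) :
  (forall u, connect e v u -> e u =1 e' u) -> connect e v =1 connect e' v.
Proof.
move=> ee' w; apply/idP/idP => /connectP [p].
- have sub : forall u, connect e v u -> path e u p -> path e' u p.
    elim: p => [|a p IHp] u vu //= /andP [ua pa].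
    by rewrite -ee' // ua /= IHp // (connect_trans vu (connect1 ua)).
  by move=> vp ->; apply/connectP; exists p => //; apply: sub.
- have sub : forall u, connect e v u -> path e' u p -> path e u p.
    elim: p => [|a p IHp] u vu //= /andP [ua pa].
    rewrite -ee' // in ua.
    by rewrite ua /= IHp // (connect_trans vu (connect1 ua)).
  by move=> vp ->; apply/connectP; exists p => //; apply: sub.
Qed.

Lemma card_connect_bij (T T' : finType) (f : T -> T') (e : rel T') (u : T) :
  bijective f -> #|connect (fun v w => e (f v) (f w)) u| = #|connect e (f u)|.
Proof.
move=> fbij; have [g fK gK] := fbij; have finj := can_inj fK.
have connf v w : connect (fun v w => e (f v) (f w)) v w = connect e (f v) (f w).
  apply/idP/idP => /connectP [p].
  - elim: p v => [|a p IHp] v /= => [_ -> //|/andP [va pa] wE].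
    exact: connect_trans (connect1 va) (IHp _ pa wE).
  - elim: p v => [|a p IHp] v /= => [_ /finj -> //|/andP [va pa] wE].
    rewrite -(gK a) in va pa wE.
    exact: connect_trans (connect1 (va : (fun v w => e (f v) (f w)) v (g a)))
             (IHp _ pa wE).
rewrite -(fintype.card_image finj); apply: eq_card => w.
rewrite -[w]gK (fintype.mem_image finj).
exact: connf.
Qed.

(* On zero vertices a graph has distance at least eps * 0 from every property, so the property must be empty there: a member would have to be both accepted and rejected. *)
Definition no_component (L N0 : nat) : graph_property := fun N G =>
  (0 < N)%N /\ (N = N0 -> forall v, #|connect (adj G) v| != L).

Lemma no_component_iso (L N0 : nat) : iso_closed (no_component L N0).
Proof.
move=> N G H s sGH [N_gt0 noL]; split=> // NN0 v.
rewrite -[v](permKV s) -(card_connect_bij (adj H)); last exact: injF_bij perm_inj.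
by rewrite (eq_card (eq_connect sGH _)) noL.
Qed.

Lemma eq_connect_sizes N (G H : graph N) (v : 'I_N) :
  (forall u, connect (adj G) v u -> adj G u =1 adj H u) ->
  #|connect (adj G) v| = #|connect (adj H) v|.
Proof. by move=> GH; apply/eq_card/connect_eq_rows. Qed.

Lemma graph_connect_sym N (G : graph N) : connect_sym (adj G).
Proof. by apply: sym_connect_sym; exact: adj_sym. Qed.

Lemma gdistxx N (G : graph N) : gdist G G = 0%N.
Proof.
by apply/eqP; rewrite cards_eq0; apply/eqP/setP => p; rewrite !inE eqxx andbF.
Qed.

Definition isolate_adj N (G : graph N) (B : {set 'I_N}) : rel 'I_N :=
  fun u v => [&& adj G u v, u \notin B & v \notin B].

Lemma isolate_sym N (G : graph N) B : symmetric (isolate_adj G B).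
Proof. by move=> u v; rewrite /isolate_adj adj_sym [in RHS]andbA [in RHS]andbAC -andbA. Qed.

Lemma isolate_irr N (G : graph N) B : irreflexive (isolate_adj G B).
Proof. by move=> u; rewrite /isolate_adj adj_irr. Qed.

Definition isolate N (G : graph N) (B : {set 'I_N}) : graph N :=
  Graph (isolate_sym G B) (isolate_irr G B).

Definition component_size_set (L N : nat) (G : graph N) : {set 'I_N} :=
  [set v | #|connect (adj G) v| == L].

Lemma component_size_set_connect (L N : nat) (G : graph N) (u v : 'I_N) :
  connect (adj G) u v ->
  (u \in component_size_set L G) = (v \in component_size_set L G).
Proof.
move=> uv; rewrite !inE; congr (_ == _); apply: eq_card => w.
exact: same_connect (@graph_connect_sym N G) _ _ uv w.
Qed.

(** Vertices of bad components become singletons, and 1 differs from [L]. No edge joins a bad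
    component to another one, so the remaining components survive unchanged. *)
Lemma isolate_no_component (L N N0 : nat) (G : graph N) : (1 < L)%N -> (0 < N)%N ->
  no_component L N0 (isolate G (component_size_set L G)).
Proof.
move=> L_gt1 N_gt0; split=> // _ v; set B := component_size_set L G.
have [vB|vB] := boolP (v \in B).
- suff -> : #|connect (adj (isolate G B)) v| = 1%N by rewrite neq_ltn L_gt1.
  rewrite -(card1 v); apply: eq_card => w; rewrite !inE.
  apply/idP/eqP => [/connectP [[|a p]] //= /andP []|->]; last exact: connect0.
  by rewrite /isolate_adj vB andbF.
- rewrite -(@eq_connect_sizes N G).
    by move: vB; rewrite inE.
  move=> u vu w /=; rewrite /isolate_adj.
  have uB : u \notin B by rewrite -(component_size_set_connect _ vu).
  rewrite uB /=; have [uw|//] := boolP (adj G u w).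
  by rewrite -(component_size_set_connect _ (connect1 uw)) uB.
Qed.

(** A deleted edge is a pair [(u, v)] with [u] bad and [v] in its component, and each bad [u] has
    exactly [L] such partners. *)
Lemma gdist_isolate (L N : nat) (G : graph N) :
  (gdist G (isolate G (component_size_set L G)) <= #|component_size_set L G| * L)%N.
Proof.
set B := component_size_set L G.
have -> : (#|B| * L = #|[set p : 'I_N * 'I_N | (p.1 \in B) && connect (adj G) p.1 p.2]|)%N.
  rewrite -[in RHS]sum1_card (eq_bigl (fun p : 'I_N * 'I_N => (p.1 \in B) && connect (adj G) p.1 p.2)); last first.
    by move=> p; rewrite inE.
  rewrite -(pair_big_dep (mem B) (fun u v => connect (adj G) u v) (fun _ _ => 1%N)) /=.
  rewrite -sum_nat_const; apply: eq_bigr => u; rewrite inE => /eqP <-.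
  by rewrite sum1_card; apply: eq_card.
apply: subset_leq_card; apply/fintype.subsetP => -[u v]; rewrite !inE /= => /andP [_].
rewrite /isolate_adj; have [uv|//] := boolP (adj G u v).
have -> : (v \notin B) = (u \notin B).
  by rewrite (component_size_set_connect _ (connect1 uv)).
rewrite andbb connect1 // andbT.
by have [uB|//] := boolP (u \in B); move: uB; rewrite inE => ->.
Qed.

(** Unless [G] and [H] differ at a pair touching block [i], the component of size [L] there survives
    in [H]. A pair touches at most two blocks, hence the factor 2. *)
Lemma gdist_ge_components (L N N0 : nat) (T : finType) (A : {set T})
    (blk : 'I_N -> T) (G H : graph N) : N = N0 -> no_component L N0 H ->
  (forall i, i \in A -> exists2 v, blk v = i &
     #|connect (adj G) v| = L /\ forall u, connect (adj G) v u -> blk u = i) ->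
  (#|A| <= 2 * gdist G H)%N.
Proof.
move=> NN0 [_ /(_ NN0) noL] compA; set D := finset (fun p : 'I_N * 'I_N => (p.1 < p.2)%N && (adj G p.1 p.2 != adj H p.1 p.2)).
apply: (@leq_trans #|[set blk p.1 | p in D] :|: [set blk p.2 | p in D]|).
  apply: subset_leq_card; apply/fintype.subsetP => i /compA [v vi [vL vblk]].
  rewrite -[_ \in _]negbK; apply/negP => iD.
  have /eqP[] := noL v; rewrite -vL; apply/esym/eq_connect_sizes => u vu w.
  apply/eqP; rewrite -[_ == _]negbK; apply/negP => uw.
  have [uw_lt|wu_lt|uw_eq] := ltngtP u w.
  - case/negP: iD; apply/setUP; left; apply/imsetP; exists (u, w) => /=.
      by rewrite inE uw_lt.
    by rewrite vblk.
  - case/negP: iD; apply/setUP; right; apply/imsetP; exists (w, u) => /=.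
      by rewrite inE wu_lt /= adj_sym (adj_sym H).
    by rewrite vblk.
  - by move: uw; rewrite (val_inj uw_eq) !adj_irr eqxx.
by rewrite (leq_trans (leq_card_setU _ _)) // mulSn mul1n leq_add // leq_imset_card.
Qed.

(** * The double covers *)

(** The coordinates are the block, the position on the cycle, the side, and the bit of the double
    cover. *)
Definition slot (m h : nat) := ('I_m.+1 * ('I_h.+1 * bool * bool))%type.

(** Without the bit, a block is a cycle of length [2 * h.+1] alternating between the sides. Rungs
    join the two sides of one position and swap the bit where [x] is true; the other edges keep the
    bit. Edges are oriented from side [false] to side [true]. *)
Definition link m h (x : {ffun 'I_m.+1 * 'I_h.+1 -> bool}) (A : {set 'I_m.+1})
    (p p' : slot m h) : bool :=
  let: (i, (l, s, b)) := p in let: (i', (l', s', b')) := p' in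
  [&& i == i', i \in A, ~~ s, s' &
    (l == l') && (b' == b (+) x (i, l)) ||
    ((l'.+1 == l :> nat) || (l == ord0) && (l' == ord_max)) && (b' == b)].

Definition ladder_rel m h (x : {ffun 'I_m.+1 * 'I_h.+1 -> bool}) (A : {set 'I_m.+1})
    (p p' : slot m h) : bool := link x A p p' || link x A p' p.

Lemma ladder_rel_sym m h (x : {ffun 'I_m.+1 * 'I_h.+1 -> bool}) A : symmetric (ladder_rel x A).
Proof. by move=> p p'; rewrite /ladder_rel orbC. Qed.

Lemma ladder_rel_irr m h (x : {ffun 'I_m.+1 * 'I_h.+1 -> bool}) A : irreflexive (ladder_rel x A).
Proof. by move=> [i [[l [] b]]]; rewrite /ladder_rel /= !andbF. Qed.

Lemma ladder_connect_block m h (x : {ffun 'I_m.+1 * 'I_h.+1 -> bool}) A p p' :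
  connect (ladder_rel x A) p p' -> p'.1 = p.1.
Proof.
case/connectP => q; elim: q p => [p _ -> //|a q IHq p /= /andP [pa qa] pE].
rewrite (IHq _ qa pE); move: pa; rewrite /ladder_rel /link.
by case: p {pE} a {IHq qa} => [i [[l s] b]] [i' [[l' s'] b']] /orP[] /and5P[/eqP -> //].
Qed.

Lemma card_block m h (i : 'I_m.+1) : #|[pred p : slot m h | p.1 == i]| = (4 * h.+1)%N.
Proof.
have -> : #|[pred p : slot m h | p.1 == i]| = #|finset.setX [set i]%SET [set: 'I_h.+1 * bool * bool]%SET|.
  by apply: eq_card => -[a b]; rewrite inE finset.in_setX finset.in_set1 finset.in_setT andbT.
by rewrite cardsX cards1 cardsT !card_prod card_ord card_bool mul1n -mulnA mulnC.
Qed.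

Definition block_parity m h (x : {ffun 'I_m.+1 * 'I_h.+1 -> bool}) (i : 'I_m.+1) : bool :=
  \big[addb/false]_(l < h.+1) x (i, l).

Definition prefix_parity m h (x : {ffun 'I_m.+1 * 'I_h.+1 -> bool}) (i : 'I_m.+1) (n : nat) :=
  \big[addb/false]_(l < h.+1 | (l < n)%N) x (i, l).

Lemma prefix_parity0 m h (x : {ffun 'I_m.+1 * 'I_h.+1 -> bool}) i : prefix_parity x i 0 = false.
Proof. by rewrite /prefix_parity big_pred0. Qed.

Lemma prefix_parity_max m h (x : {ffun 'I_m.+1 * 'I_h.+1 -> bool}) i :
  prefix_parity x i h.+1 = block_parity x i.
Proof. by apply: eq_bigl => l; rewrite ltn_ord. Qed.

Lemma prefix_parityS m h (x : {ffun 'I_m.+1 * 'I_h.+1 -> bool}) i (l : 'I_h.+1) :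
  prefix_parity x i l.+1 = prefix_parity x i l (+) x (i, l).
Proof.
rewrite /prefix_parity (bigD1 l) //= addbC; congr (_ (+) _); apply: eq_bigl => l'.
by rewrite ltnS ltn_neqAle andbC.
Qed.

(* In a block of even parity the double cover is trivial, and this is the index of the sheet. *)
Definition sheet m h (x : {ffun 'I_m.+1 * 'I_h.+1 -> bool}) (p : slot m h) : bool :=
  let: (i, (l, s, b)) := p in b (+) prefix_parity x i (if s then l.+1 else l).

(** The prefix parity compensates each crossing passed so far. Only the edge closing the cycle could
    break the invariant: there the prefix parity drops from the block parity to 0, which is no
    change when the block is even. *)
Lemma ladder_connect_sheet m h (x : {ffun 'I_m.+1 * 'I_h.+1 -> bool}) A p p' :
  ~~ block_parity x p.1 -> connect (ladder_rel x A) p p' -> sheet x p' = sheet x p.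
Proof.
move=> even_p.
have linkS a a' : ~~ block_parity x a.1 -> link x A a a' -> sheet x a' = sheet x a.
  case: a a' => [i [[l s] b]] [i' [[l' s'] b']] /= even_i /and5P [/eqP <- _ /negbTE -> ->].
  case/orP => /andP [].
    move=> /eqP <- /eqP ->; rewrite prefix_parityS.
    by case: (prefix_parity _ _ _) (x _) b => [] [] [].
  case/orP => [/eqP -> /eqP -> //|/andP [/eqP -> /eqP ->] /eqP ->].
  by rewrite /= prefix_parity0 prefix_parity_max (negbTE even_i).
case/connectP => q; elim: q p even_p => [p _ _ -> //|a q IHq p even_p /= /andP [pa qa] pE].
have ap : a.1 = p.1 by apply: ladder_connect_block (connect1 pa).
rewrite (IHq _ _ qa pE); last by rewrite ap.
by move: pa => /orP [/linkS ->|/linkS <-] //; rewrite ap.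
Qed.

Lemma ladder_even m h (x : {ffun 'I_m.+1 * 'I_h.+1 -> bool}) (A : {set 'I_m.+1}) (p : slot m h) :
  ~~ block_parity x p.1 -> #|connect (ladder_rel x A) p| != (4 * h.+1)%N.
Proof.
move=> even_p; rewrite -(card_block h p.1) neq_ltn; apply/orP; left.
apply: fintype.proper_card; apply/fintype.properP; split.
  by apply/fintype.subsetP => p' /ladder_connect_block pp'; rewrite inE pp'.
case: p even_p => [i [[l s] b]] even_p.
exists (i, (l, s, ~~ b)); first by rewrite inE.
apply/negP => /(ladder_connect_sheet even_p) /=.
by case: (b); case: (prefix_parity _ _ _).
Qed.

(** One turn around the cycle accumulates the block parity. When it is odd the walk returns to its
    starting position with the bit negated, so the two sheets are joined. *)
Lemma ladder_odd m h (x : {ffun 'I_m.+1 * 'I_h.+1 -> bool}) (A : {set 'I_m.+1}) (p : slot m h) :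
  p.1 \in A -> block_parity x p.1 -> #|connect (ladder_rel x A) p| = (4 * h.+1)%N.
Proof.
move=> pA odd_p; rewrite -(card_block h p.1); apply: eq_card => p'; rewrite inE.
apply/idP/eqP => [/ladder_connect_block //|].
have csym : connect_sym (ladder_rel x A) by apply/sym_connect_sym/ladder_rel_sym.
pose i := p.1; pose root b : slot m h := (i, (ord0, false, b)).
have step0 (l : 'I_h.+1) b :
    connect (ladder_rel x A) (i, (l, false, b)) (i, (l, true, b (+) x (i, l))).
  by apply/connect1/orP; left; rewrite /link !eqxx pA.
have reach0 n (lt_n : (n < h.+1)%N) b :
    connect (ladder_rel x A) (root b)
      (i, (Ordinal lt_n, false, b (+) prefix_parity x i n)).
  elim: n lt_n => [|n IHn] lt_n.
    rewrite prefix_parity0 addbF (_ : Ordinal lt_n = ord0) //; exact: val_inj.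
  have lt_n' := ltnW lt_n.
  apply: connect_trans (IHn lt_n') _.
  apply: connect_trans (step0 _ _) _.
  rewrite -addbA -(prefix_parityS x i (Ordinal lt_n')).
  by apply/connect1/orP; right; rewrite /link /= !eqxx pA orbT.
have reach1 (l : 'I_h.+1) b :
    connect (ladder_rel x A) (root b) (i, (l, true, b (+) prefix_parity x i l.+1)).
  apply: connect_trans (reach0 l (ltn_ord l) b) _.
  rewrite prefix_parityS addbA (_ : Ordinal _ = l); last exact: val_inj.
  exact: step0.
(* The last side of the last position is joined to position 0, which completes the turn. *)
have swap b : connect (ladder_rel x A) (root b) (root (~~ b)).
  apply: connect_trans (reach1 ord_max b) _.
  rewrite prefix_parity_max odd_p addbT.
  by apply/connect1/orP; right; rewrite /link /= !eqxx pA orbT.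
have root_false b : connect (ladder_rel x A) (root false) (root b).
  by case: b; [exact: swap | exact: connect0].
have to_root (a : slot m h) : a.1 = i -> connect (ladder_rel x A) (root false) a.
  case: a => [i' [[l s] b]] /= ->; case: s.
    rewrite -[b](addbK (prefix_parity x i l.+1)).
    exact: connect_trans (root_false _) (reach1 _ _).
  rewrite -[b](addbK (prefix_parity x i l)).
  rewrite (_ : l = Ordinal (ltn_ord l)); last exact: val_inj.
  exact: connect_trans (root_false _) (reach0 _ _ _).
by move=> pp'; apply: (connect_trans (y := root false)); rewrite ?to_root // csym to_root.
Qed.

(** Each column, given by a position and a side, is rotated cyclically among the blocks by its own
    amount. The amounts [y] are the randomness of the hard instances. *)
Definition shift m h (y : {ffun 'I_h.+1 -> 'I_m.+1 * 'I_m.+1}) (p : slot m h) : slot m h :=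
  let: (i, (l, s, b)) := p in (i + (if s then (y l).2 else (y l).1), (l, s, b)).

Lemma shift_inj m h (y : {ffun 'I_h.+1 -> 'I_m.+1 * 'I_m.+1}) : injective (@shift m h y).
Proof.
move=> [i [[l s] b]] [i' [[l' s'] b']] /= /eqP; rewrite !xpair_eqE.
move=> /andP [/eqP iE /andP [/andP [/eqP lE /eqP sE] /eqP bE]].
by rewrite -lE -sE in iE; rewrite (addIr _ iE) lE sE bE.
Qed.

Definition position m h (y : {ffun 'I_h.+1 -> 'I_m.+1 * 'I_m.+1})
    (v : 'I_#|{: slot m h}|) : slot m h := shift y (enum_val v).

Lemma position_bij m h (y : {ffun 'I_h.+1 -> 'I_m.+1 * 'I_m.+1}) : bijective (position y).
Proof.
apply: bij_comp; first exact: injF_bij (@shift_inj _ _ y).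
exact: enum_val_bij.
Qed.

Definition ladder_adj m h y (x : {ffun 'I_m.+1 * 'I_h.+1 -> bool}) (A : {set 'I_m.+1}) :
  rel 'I_#|{: slot m h}| := fun u v => ladder_rel x A (position y u) (position y v).

Lemma ladder_adj_sym m h y (x : {ffun 'I_m.+1 * 'I_h.+1 -> bool}) (A : {set 'I_m.+1}) :
  symmetric (ladder_adj y x A).
Proof. by move=> u v; apply: ladder_rel_sym. Qed.

Lemma ladder_adj_irr m h y (x : {ffun 'I_m.+1 * 'I_h.+1 -> bool}) (A : {set 'I_m.+1}) :
  irreflexive (ladder_adj y x A).
Proof. by move=> u; apply: ladder_rel_irr. Qed.

Definition ladder m h y (x : {ffun 'I_m.+1 * 'I_h.+1 -> bool}) A : graph #|{: slot m h}| :=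
  Graph (ladder_adj_sym y x A) (ladder_adj_irr y x A).

Lemma card_slot m h : #|{: slot m h}| = (4 * h.+1 * m.+1)%N.
Proof. by rewrite !card_prod !card_ord card_bool; lia. Qed.

Lemma ladder_even_no_component m h y (x : {ffun 'I_m.+1 * 'I_h.+1 -> bool}) (A : {set 'I_m.+1}) :
  (forall i, ~~ block_parity x i) ->
  no_component (4 * h.+1) #|{: slot m h}| (ladder y x A).
Proof.
move=> even_x; split=> [|_ v]; first by rewrite card_slot.
by rewrite (card_connect_bij (ladder_rel x A) v (position_bij y)) ladder_even.
Qed.

Lemma gdist_ladder_odd m h y (x : {ffun 'I_m.+1 * 'I_h.+1 -> bool}) (A : {set 'I_m.+1})
    (H : graph #|{: slot m h}|) :
  (forall i, block_parity x i) -> no_component (4 * h.+1) #|{: slot m h}| H ->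
  (#|A| <= 2 * gdist (ladder y x A) H)%N.
Proof.
move=> odd_x PH.
apply: (gdist_ge_components (blk := fun v => (position y v).1) erefl PH) => i iA.
have [g gK gK'] := position_bij y.
exists (g (i, (ord0, false, false))); first by rewrite gK'.
have connG u v : connect (ladder_adj y x A) u v ->
    connect (ladder_rel x A) (position y u) (position y v).
  case/connectP => q; elim: q u => [u _ -> //|a q IHq u /= /andP [ua qa] vE].
  exact: connect_trans (connect1 (ua : ladder_rel x A (position y u) (position y a)))
    (IHq _ qa vE).
split=> [|u /connG /ladder_connect_block]; last by rewrite gK'.
by rewrite (card_connect_bij (ladder_rel x A) _ (position_bij y)) gK' ladder_odd.
Qed.

(** * Exploring components with decision trees *)

Fixpoint dt_bind N (t1 t2 : dtree N) : dtree N :=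
  match t1 with
  | Leaf b => if b then t2 else Leaf N false
  | Node u v a b => Node u v (dt_bind a t2) (dt_bind b t2)
  end.

Lemma dt_run_bind N (t1 t2 : dtree N) g :
  dt_run (dt_bind t1 t2) g = dt_run t1 g && dt_run t2 g.
Proof.
by elim: t1 => [[]|u v a IHa b IHb] //=; rewrite IHa IHb; case: (g u v).
Qed.

Lemma dt_cost_bind N (t1 t2 : dtree N) g :
  (dt_cost (dt_bind t1 t2) g <= dt_cost t1 g + dt_cost t2 g)%N.
Proof.
by elim: t1 => [[]|u v a IHa b IHb] //=; case: (g u v); rewrite addSn ltnS.
Qed.

(** Continuation-passing style: the rest of the tree depends on the neighbours found, which are
    known only at the leaves of this part. *)
Fixpoint query_row N (u : 'I_N) (s : seq 'I_N) (found : {set 'I_N})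
    (k : {set 'I_N} -> dtree N) : dtree N :=
  match s with
  | [::] => k found
  | v :: s' => Node u v (query_row u s' found k) (query_row u s' (v |: found)%SET k)
  end.

Lemma dt_run_query_row N (u : 'I_N) s found k g :
  dt_run (query_row u s found k) g = dt_run (k (found :|: [set v in s | g u v])%SET) g.
Proof.
elim: s found => [|v s IHs] found /=.
  by congr (dt_run (k _) g); apply/setP => v; rewrite !inE orbF.
have [uv|uv] := boolP (g u v); rewrite IHs; congr (dt_run (k _) g);
  apply/setP => w; rewrite !inE.
- by case: (eqVneq w v) => [->|_]; rewrite ?uv ?orbT.
- by case: (eqVneq w v) => [->|_]; rewrite ?(negbTE uv) ?andbF.
Qed.

Lemma dt_cost_query_row N (u : 'I_N) s found k g c :
  (forall found', dt_cost (k found') g <= c)%N ->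
  (dt_cost (query_row u s found k) g <= size s + c)%N.
Proof.
move=> kc; elim: s found => [|v s IHs] found //=.
by case: (g u v); rewrite addSn ltnS IHs.
Qed.

(* Explores from [seen], of which the vertices in [done] have already been expanded, with at most [n] further expansions; accepts unless the exploration closes up on exactly [L] vertices. *)
Fixpoint explore N (L n : nat) (done seen : {set 'I_N}) : dtree N :=
  match [pick u in seen :\: done] with
  | None => Leaf N (#|seen| != L)
  | Some u =>
    if n is n'.+1 then
      query_row u (enum 'I_N) finset.set0 (fun row => explore L n' (u |: done) (seen :|: row))%SET
    else Leaf N true
  end.

Lemma dt_cost_explore N (L n : nat) (done seen : {set 'I_N}) g :
  (dt_cost (explore L n done seen) g <= n * N)%N.
Proof.
elim: n done seen => [|n IHn] done seen /=; first by case: pickP.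
case: pickP => //= u _; rewrite mulSn -[X in (_ <= X + _)%N](size_enum_ord N).
exact: dt_cost_query_row.
Qed.

(** If no vertex is pending, [seen] is closed under adjacency and equals the component. The equation
    on [#|done| + n] makes the budget run out exactly when [L] vertices have been expanded. *)
Lemma dt_run_explore N (G : graph N) (L n : nat) (v : 'I_N) (done seen : {set 'I_N}) :
  (#|done| + n = L)%N -> v \in seen -> done \subset seen ->
  (forall u, u \in seen -> connect (adj G) v u) ->
  (forall u w, u \in done -> adj G u w -> w \in seen) ->
  dt_run (explore L n done seen) (adj G) = (#|connect (adj G) v| != L).
Proof.
have explored (done' seen' : {set 'I_N}) : (forall u, (u \in (seen' :\: done')%SET) = false) -> v \in seen' ->
    (forall u, u \in seen' -> connect (adj G) v u) ->
    (forall u w, u \in done' -> adj G u w -> w \in seen') ->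
    #|seen'| = #|connect (adj G) v|.
  move=> seen_done vseen seen_comp done_closed; apply: eq_card => w.
  apply/idP/idP => [/seen_comp //|]; case/connectP => p.
  elim: p (v) vseen => [|a p IHp] b bs /= => [_ -> //|/andP [ba pa] wE].
  have b_done : b \in done' by have := seen_done b; rewrite !inE bs andbT => /negbFE.
  exact: IHp (done_closed b a b_done ba) pa wE.
elim: n done seen => [|n IHn] done seen dL vseen done_seen seen_comp done_closed /=.
- case: pickP => [u|seen_done] /=; last by rewrite (explored _ _ seen_done).
  (* The [L] expanded vertices and the pending [u] all lie in the component, so its size exceeds [L]
     and accepting is correct. *)
  rewrite !inE => /andP [u_done u_seen]; apply/esym; rewrite neq_ltn; apply/orP; right.
  rewrite -dL addn0; apply: fintype.proper_card; apply/fintype.properP; split.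
    by apply/fintype.subsetP => w /(fintype.subsetP done_seen)/seen_comp.
  by exists u => //; apply: seen_comp.
- case: pickP => [u|seen_done] /=; last by rewrite (explored _ _ seen_done).
  rewrite !inE => /andP [u_done u_seen]; rewrite dt_run_query_row.
  have -> : (finset.set0 :|: [set w in enum 'I_N | adj G u w] = [set w | adj G u w])%SET.
    by apply/setP => w; rewrite !inE mem_enum.
  apply: IHn => [||||u' w].
  + by rewrite cardsU1 u_done -dL addnS.
  + by rewrite inE vseen.
  + apply/fintype.subsetP => w; rewrite !inE => /orP [/eqP ->|/(fintype.subsetP done_seen) ->] //.
    by rewrite u_seen.
  + move=> w; rewrite !inE => /orP [/seen_comp //|uw].
    exact: connect_trans (seen_comp _ u_seen) (connect1 uw).
  + rewrite !inE => /orP [/eqP -> -> |u'_done /(done_closed _ _ u'_done) ->] //.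
    by rewrite orbT.
Qed.

Definition sample_tree N (L : nat) (s : seq 'I_N) : dtree N :=
  foldr (fun v => dt_bind (explore L L finset.set0 [set v]%SET)) (Leaf N true) s.

Lemma dt_run_sample_tree N (G : graph N) (L : nat) (s : seq 'I_N) :
  dt_run (sample_tree L s) (adj G) = all (fun v => #|connect (adj G) v| != L) s.
Proof.
elim: s => //= v s IHs; rewrite dt_run_bind IHs; congr (_ && _).
apply: dt_run_explore => [||||u w]; rewrite ?cards0 ?finset.in_set0 //.
- by rewrite finset.in_set1.
- by apply/fintype.subsetP => u; rewrite finset.in_set0.
- by move=> u; rewrite finset.in_set1 => /eqP ->.
Qed.

Lemma dt_cost_sample_tree N (L : nat) (s : seq 'I_N) g :
  (dt_cost (sample_tree L s) g <= size s * (L * N))%N.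
Proof.
elim: s => //= v s IHs; apply: leq_trans (dt_cost_bind _ _ _) _.
by rewrite mulSn leq_add // dt_cost_explore.
Qed.

Fixpoint dt_path N (t : dtree N) (g : rel 'I_N) : seq ('I_N * 'I_N) :=
  match t with
  | Leaf _ => [::]
  | Node u v t0 t1 => (u, v) :: (if g u v then dt_path t1 g else dt_path t0 g)
  end.

Lemma size_dt_path N (t : dtree N) g : size (dt_path t g) = dt_cost t g.
Proof. by elim: t => //= u v a IHa b IHb; case: (g u v); rewrite ?IHa ?IHb. Qed.

Lemma eq_dt_run N (t : dtree N) (g g' : rel 'I_N) :
  all (fun p => g p.1 p.2 == g' p.1 p.2) (dt_path t g) -> dt_run t g = dt_run t g'.
Proof.
elim: t => //= u v a IHa b IHb /andP [/eqP <-].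
by case: (g u v) => [/IHb|/IHa].
Qed.

(** * Lower bounds *)

Lemma ler_sum_In (R : realType) (A : Type) (D : seq A) (F G : A -> R) :
  (forall x, Stdlib.Lists.List.In x D -> F x <= G x) ->
  \sum_(x <- D) F x <= \sum_(x <- D) G x.
Proof.
elim: D => [|x D IHD] FG; first by rewrite !big_nil.
rewrite !big_cons lerD ?FG //; first by left.
by apply: IHD => z zD; apply: FG; right.
Qed.

(** Exchanging the sums turns a randomized algorithm on fixed inputs into fixed algorithms on a
    uniformly chosen input. *)
Lemma sum_acc_prob (R : realType) (A : Type) (D : seq (R * A)) (I : finType)
    (Y : {set I}) (run : I -> A -> bool) :
  \sum_(i in Y) acc_prob (run i) D =
  \sum_(x <- D) x.1 * #|[set i in Y | run i x.2]|%:R.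
Proof.
rewrite exchange_big /=; apply: eq_bigr => x _.
rewrite -mulr_sumr; congr (_ * _).
rewrite -natr_sum; congr _%:R.
rewrite -sum1_card [RHS](eq_bigl (fun i => (i \in Y) && run i x.2)); last first.
  by move=> i; rewrite inE.
by rewrite big_mkcondr /=; apply: eq_bigr => i _; case: (run i x.2).
Qed.

(** Yao's averaging argument: total acceptance is at least two thirds of [#|Y|] on [Y] and at most
    one third of it on [Z], while each deterministic algorithm contributes a gap of at most [c]. *)
Lemma average_gap (R : realType) (A : Type) (D : seq (R * A)) (I : finType)
    (Y Z : {set I}) (run run' : I -> A -> bool) (c : nat) :
  is_distr D -> (#|Z| <= #|Y|)%N ->
  (forall i, i \in Y -> acc_prob (run i) D > 2%:R / 3%:R) ->
  (forall i, i \in Z -> 1 - acc_prob (run' i) D > 2%:R / 3%:R) ->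
  (forall x, Stdlib.Lists.List.In x D ->
    #|[set i in Y | run i x.2]| <= #|[set i in Z | run' i x.2]| + c)%N ->
  (#|Y| <= 3 * c)%N.
Proof.
move=> [D_ge0 D1] ZY accY rejZ gap.
have lowY : #|Y|%:R * (2%:R / 3%:R) <= \sum_(i in Y) acc_prob (run i) D.
  rewrite mulr_natl -sumr_const; apply: ler_sum => i /accY; exact: ltW.
have upZ : \sum_(i in Z) acc_prob (run' i) D <= #|Y|%:R * (1 / 3%:R).
  apply: (@le_trans _ _ (#|Z|%:R * (1 / 3%:R))).
    rewrite mulr_natl -sumr_const; apply: ler_sum => i /rejZ; lra.
  by rewrite ler_wpM2r // ler_nat.
have YZ : \sum_(i in Y) acc_prob (run i) D <= \sum_(i in Z) acc_prob (run' i) D + c%:R.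
  have -> : c%:R = \sum_(x <- D) x.1 * c%:R :> R by rewrite -mulr_suml D1 mul1r.
  rewrite !sum_acc_prob -big_split /=.
  apply: ler_sum_In => x xD; rewrite -mulrDr -natrD ler_wpM2l ?D_ge0 //.
  by rewrite ler_nat gap.
rewrite -(ler_nat R) natrM; lra.
Qed.

(** * The adaptive lower bound *)

Lemma card_has_le (T : Type) (J : finType) (F : J -> T -> bool) (s : seq T) (c : nat) :
  (forall q, #|[set j | F j q]| <= c)%N -> (#|[set j | has (F j) s]| <= size s * c)%N.
Proof.
move=> Fc; elim: s => [|q s IHs].
  by rewrite leqn0 cards_eq0; apply/eqP/setP => j; rewrite !inE.
rewrite (_ : [set j | _]%SET = [set j | F j q] :|: [set j | has (F j) s])%SET; last first.
  by apply/setP => j; rewrite !inE.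
by rewrite (leq_trans (leq_card_setU _ _)) // mulSn leq_add.
Qed.

(** All columns on one side share a shift here. Adjacent vertices lie on opposite sides of one block
    [j] in [A], and [j] determines both shifts; [g j] is that pair. *)
Lemma card_shift_adj m h (x : {ffun 'I_m.+1 * 'I_h.+1 -> bool}) (A : {set 'I_m.+1})
    (u v : 'I_#|{: slot m h}|) :
  (#|[set ab | ladder_adj [ffun=> ab] x A u v]| <= #|A|)%N.
Proof.
have [[i [[l s] b]] uE] : exists p, p = enum_val u by exists (enum_val u).
have [[i' [[l' s'] b']] vE] : exists p, p = enum_val v by exists (enum_val v).
pose g j := if s then (j - i', j - i) else (j - i, j - i').
apply: (@leq_trans #|[set g j | j in A]|); last exact: leq_imset_card.
apply: subset_leq_card; apply/fintype.subsetP => -[a c].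
rewrite inE /ladder_adj /position -uE -vE /ladder_rel /= !ffunE /= => adj_uv.
suff [j [jA ->]] : exists j, j \in A /\ (a, c) = g j by apply: imset_f.
move: adj_uv; rewrite /g.
case/orP => /and5P [/eqP iE iA /negbTE sE s'E _].
- exists (i + a); rewrite sE s'E in iE iA *; split=> //.
  by rewrite addrAC subrr add0r iE addrAC subrr add0r.
- exists (i' + a); rewrite sE s'E in iE iA *; split=> //.
  by rewrite addrAC subrr add0r iE addrAC subrr add0r.
Qed.

Definition empty_graph (N : nat) : graph N :=
  @Graph N (fun _ _ => false) (fun _ _ => erefl) (fun _ => erefl).

Lemma empty_no_component (L N N0 : nat) : (1 < L)%N -> (0 < N)%N ->
  no_component L N0 (empty_graph N).
Proof.
move=> L_gt1 N_gt0; split=> // _ v.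
suff -> : #|connect (adj (empty_graph N)) v| = 1%N by rewrite neq_ltn L_gt1.
rewrite -(card1 v); apply: eq_card => w; rewrite !inE.
by apply/idP/eqP => [/connectP [[|a p]]|->] //; exact: connect0.
Qed.

(** A tree notices a difference from the empty graph only if one of the at most [k] queries on its
    all-negative path hits an edge. Each query does so for at most [#|A|] of the [m.+1 ^ 2] pairs of
    shifts. *)
Lemma adaptive_lower (R : realType) (m h k : nat) (A : {set 'I_m.+1}) (eps : R) :
  2 * (eps * (#|{: slot m h}| ^ 2)%:R) <= #|A|%:R ->
  adaptive_tester (no_component (4 * h.+1) #|{: slot m h}|) eps k ->
  (m.+1 ^ 2 <= 3 * (k * #|A|))%N.
Proof.
move=> eps_le [T [T_distr [T_cost [T_acc T_rej]]]].
(* A single crossing, at position 0, makes every block odd. *)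
pose x : {ffun 'I_m.+1 * 'I_h.+1 -> bool} := [ffun q => q.2 == ord0].
have odd_x i : block_parity x i.
  by rewrite /block_parity (bigD1 ord0) //= ffunE big1 // => l; rewrite ffunE; exact: negbTE.
set N := #|{: slot m h}| in eps_le *.
pose G (ab : 'I_m.+1 * 'I_m.+1) : graph N := ladder [ffun=> ab] x A.
have := @average_gap R _ (T N) ('I_m.+1 * 'I_m.+1)%type finset.setT finset.setT
  (fun _ t => dt_run t (adj (empty_graph N))) (fun ab t => dt_run t (adj (G ab))) (k * #|A|).
rewrite cardsT card_prod card_ord; apply=> //.
- move=> _ _; apply: T_acc; apply: empty_no_component; first by lia.
  by rewrite /N card_slot.
- move=> ab _; apply: T_rej => H /(gdist_ladder_odd [ffun=> ab] A odd_x).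
  rewrite -(ler_nat R) natrM => /(le_trans eps_le).
  by rewrite ler_pM2l.
move=> [w t] tT /=.
have [run_t|run_t] := boolP (dt_run t (adj (empty_graph N))); last first.
  rewrite (_ : [set i in _ | _]%SET = finset.set0) ?cards0 //.
  by apply/setP => i; rewrite !inE.
(* Shifts outside [Z] are those where the tree rejects, so its path on the empty graph must hit an
   edge. *)
set Z := [set i in _ | dt_run t (adj (G i))]%SET.
apply: leq_trans (max_card _) _; rewrite -(cardsC Z) leq_add2l.
apply: (@leq_trans (size (dt_path t (adj (empty_graph N))) * #|A|)); last first.
  by rewrite leq_mul2r size_dt_path (T_cost _ _ _ tT) orbT.
have hits := card_has_le (F := fun ab p => adj (G ab) p.1 p.2)
  (dt_path t (adj (empty_graph N))) (fun p => card_shift_adj x A p.1 p.2).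
apply: leq_trans hits.
apply: subset_leq_card; apply/fintype.subsetP => ab; rewrite !inE /= => run_G.
rewrite -[has _ _]negbK -all_predC; apply/negP => no_hit.
by case/negP: run_G; rewrite -(eq_dt_run (g := adj (empty_graph N))).
Qed.

(** * The non-adaptive lower bound *)

Definition flip m h (x : {ffun 'I_m.+1 * 'I_h.+1 -> bool}) (f : 'I_m.+1 -> 'I_h.+1) :
  {ffun 'I_m.+1 * 'I_h.+1 -> bool} := [ffun q => x q (+) (q.2 == f q.1)].

Lemma flipK m h (f : 'I_m.+1 -> 'I_h.+1) : involutive (@flip m h ^~ f).
Proof. by move=> x; apply/ffunP => q; rewrite !ffunE addbK. Qed.

Lemma block_parity_flip m h (x : {ffun 'I_m.+1 * 'I_h.+1 -> bool}) f i :
  block_parity (flip x f) i = ~~ block_parity x i.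
Proof.
rewrite /block_parity (eq_bigr (fun l => x (i, l) (+) (l == f i))); last first.
  by move=> l _; rewrite ffunE.
rewrite big_split /= (_ : \big[addb/false]_(l < h.+1) (l == f i) = true) ?addbT //.
by rewrite (bigD1 (f i)) //= eqxx big1 // => l /negbTE.
Qed.

Definition rung m h (i : 'I_m.+1) (l : 'I_h.+1) (p p' : slot m h) : bool :=
  let: (j, (n, s, b)) := p in let: (j', (n', s', b')) := p' in
  [&& j == i, j' == i, n == l, n' == l & ~~ s && s'].

Lemma link_flip m h (x : {ffun 'I_m.+1 * 'I_h.+1 -> bool}) f A (p p' : slot m h) :
  ~~ rung p.1 (f p.1) p p' -> link (flip x f) A p p' = link x A p p'.
Proof.
case: p p' => [i [[l s] b]] [i' [[l' s'] b']] /=; rewrite eqxx /= ffunE /=.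
case: (eqVneq i i') => [_|_] //=.
case: s => //=; case: s' => //=; rewrite ?andbF ?andbT //.
case: (eqVneq l l') => [<-|_] //=; rewrite andbb => /negbTE ->.
by rewrite addbF.
Qed.

Definition on_rung m h (y : {ffun 'I_h.+1 -> 'I_m.+1 * 'I_m.+1}) i l
    (q : 'I_#|{: slot m h}| * 'I_#|{: slot m h}|) : bool :=
  rung i l (position y q.1) (position y q.2) || rung i l (position y q.2) (position y q.1).

Lemma ladder_adj_flip m h (y : {ffun 'I_h.+1 -> 'I_m.+1 * 'I_m.+1}) x f A q :
  (forall i, ~~ on_rung y i (f i) q) ->
  ladder_adj y (flip x f) A q.1 q.2 = ladder_adj y x A q.1 q.2.
Proof.
move=> off; rewrite /ladder_adj /ladder_rel !link_flip //.
- by have := off (position y q.2).1; rewrite negb_or => /andP [].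
- by have := off (position y q.1).1; rewrite negb_or => /andP [].
Qed.

(** Events at distinct positions thus depend on distinct coordinates of [y], which allows their
    counts to be multiplied. *)
Lemma on_rung_local m h (y : {ffun 'I_h.+1 -> 'I_m.+1 * 'I_m.+1}) i l q :
  on_rung y i l q = on_rung [ffun=> y l] i l q.
Proof.
have rungE p p' : rung i l (shift y p) (shift y p') =
    rung i l (shift [ffun=> y l] p) (shift [ffun=> y l] p').
  case: p p' => [j [[n s] b]] [j' [[n' s'] b']] /=; rewrite !ffunE.
  case: (eqVneq n l) => [->|_]; last by rewrite !andbF.
  by case: (eqVneq n' l) => [->|_] //; rewrite !andbF.
by rewrite /on_rung /position !rungE.
Qed.

(** Both endpoints must land in the given block [i], one on each side, and this fixes both
    shifts. *)
Lemma card_on_rung m h i l (q : 'I_#|{: slot m h}| * 'I_#|{: slot m h}|) :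
  (#|[set ab | on_rung [ffun=> ab] i l q]| <= 1)%N.
Proof.
case: q => u v.
have [[j [[n s] b]] uE] : exists p, p = enum_val u by exists (enum_val u).
have [[j' [[n' s'] b']] vE] : exists p, p = enum_val v by exists (enum_val v).
apply: (@leq_trans #|[set if s then (i - j', i - j) else (i - j, i - j')]%SET|);
  last by rewrite cards1.
apply: subset_leq_card; apply/fintype.subsetP => -[a c].
rewrite !inE /on_rung /position -uE -vE /= !ffunE /=.
by case/orP => /and5P [/eqP iE1 /eqP iE2 _ _ /andP [/negbTE s0 s1]];
  rewrite s0 s1 in iE1 iE2 *; rewrite -{1}iE1 -iE2 addrAC subrr add0r addrAC subrr add0r.
Qed.

(** For a fixed block, each coordinate [y l] is confined to at most [size S] pairs, so the functions
    form a product of small sets; the factor [m.+1] is a union bound over blocks. *)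
Lemma card_blocked m h (S : seq ('I_#|{: slot m h}| * 'I_#|{: slot m h}|)) :
  (#|[set y : {ffun 'I_h.+1 -> 'I_m.+1 * 'I_m.+1} |
      [exists i, forall l, has (on_rung y i l) S]]| <= m.+1 * size S ^ h.+1)%N.
Proof.
pose F i l := [set ab : 'I_m.+1 * 'I_m.+1 | has (on_rung [ffun=> ab] i l) S]%SET.
have cardF i l : (#|F i l| <= size S)%N.
  rewrite -[size S]muln1; apply: card_has_le => q; exact: card_on_rung.
apply: (@leq_trans (\sum_(i < m.+1) #|family (F i)|)); last first.
  rewrite -[X in (_ <= X * _)%N](card_ord m.+1) -sum_nat_const; apply: leq_sum => i _.
  rewrite card_family foldrE big_image /= -[X in (_ <= _ ^ X)%N](card_ord h.+1).
  by rewrite -prod_nat_const; apply: leq_prod.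
apply: (@leq_trans #|\bigcup_(i < m.+1) [set y in family (F i)]|%SET); last first.
  elim/big_rec2: _ => [|i B c _ IH]; first by rewrite cards0.
  by rewrite (leq_trans (leq_card_setU _ _)) // cardsE leq_add.
apply: subset_leq_card; apply/fintype.subsetP => y; rewrite inE => /existsP [i /forallP yi].
apply/finset.bigcupP; exists i => //; rewrite inE; apply/familyP => l; rewrite inE.
by rewrite (eq_has (a2 := on_rung y i l)) // => q; rewrite [RHS]on_rung_local.
Qed.

(** For unblocked shifts, flipping one unqueried rung per block matches even with odd instances
    without changing an answer. If [4 * k] were at most [m.+1 ^ 2], the blocked shifts would be a
    fraction at most [m.+1 / 4 ^ h.+1], less than one third. *)
Lemma nonadaptive_lower (R : realType) (m h k : nat) (eps : R) :
  2 * (eps * (#|{: slot m h}| ^ 2)%:R) <= m.+1%:R -> (3 * m.+1 < 4 ^ h.+1)%N ->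
  nonadaptive_tester (no_component (4 * h.+1) #|{: slot m h}|) eps k ->
  (m.+1 ^ 2 < 4 * k)%N.
Proof.
move=> eps_le h_large [T [T_distr [T_cost [T_acc T_rej]]]].
rewrite ltnNge; apply/negP => k_small.
set N := #|{: slot m h}| in eps_le *.
pose Sh := {ffun 'I_h.+1 -> 'I_m.+1 * 'I_m.+1}.
pose X := {ffun 'I_m.+1 * 'I_h.+1 -> bool}.
pose E := [set x : X | [forall i, ~~ block_parity x i]]%SET.
pose O := [set x : X | [forall i, block_parity x i]]%SET.
pose G (q : Sh * X) : graph N := ladder q.1 q.2 [set: 'I_m.+1].
pose Y := finset.setX [set: Sh]%SET E; pose Z := finset.setX [set: Sh]%SET O.
have EO : #|O| = #|E|.
  rewrite -(card_imset E (inv_inj (@flipK m h (fun=> ord0)))); apply: eq_card => x.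
  rewrite inE; apply/forallP/imsetP => [odd_x|[x' + ->] i].
    exists (flip x (fun=> ord0)); last by rewrite flipK.
    by rewrite inE; apply/forallP => i; rewrite block_parity_flip odd_x.
  by rewrite inE block_parity_flip => /forallP.
have := @average_gap R _ (T N) (Sh * X)%type Y Z
  (fun q t => na_run t (adj (G q))) (fun q t => na_run t (adj (G q)))
  (m.+1 * k ^ h.+1 * #|E|).
rewrite !cardsX cardsT EO => gap.
have : (#|Sh| * #|E| <= 3 * (m.+1 * k ^ h.+1 * #|E|))%N.
  apply: gap => //.
  - move=> q; rewrite !inE => /andP [_ /forallP even_q].
    by apply: T_acc; apply: ladder_even_no_component.
  - move=> q; rewrite !inE => /andP [_ /forallP odd_q].
    apply: T_rej => H /(gdist_ladder_odd q.1 finset.setT odd_q).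
    rewrite cardsT card_ord -(ler_nat R) natrM => /(le_trans eps_le).
    by rewrite ler_pM2l.
  move=> [w t] tT /=.
  pose blocked (y : Sh) := [exists i, forall l, has (on_rung y i l) (na_queries t)].
  (* The rung depends on [y] and the queries but not on [x], so that [flips] below is injective. The
     default [ord0] occurs only for blocked [y]. *)
  pose free (y : Sh) i := odflt ord0 [pick l | ~~ has (on_rung y i l) (na_queries t)].
  have freeP y i : ~~ blocked y -> ~~ has (on_rung y i (free y i)) (na_queries t).
    rewrite negb_exists => /forallP /(_ i); rewrite negb_forall /free => /existsP [l l_free].
    by case: pickP => [//|/(_ l)]; rewrite l_free.
  have run_flip y x : ~~ blocked y ->
      na_run t (adj (G (y, flip x (free y)))) = na_run t (adj (G (y, x))).
    move=> y_free; congr (na_decide t _); apply/eq_in_map => q qt.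
    apply: ladder_adj_flip => i; apply: contra (freeP y i y_free) => ?.
    by apply/hasP; exists q.
  pose W := [set q in Z | na_run t (adj (G q))]%SET.
  pose flips (q : Sh * X) := (q.1, flip q.2 (free q.1)).
  have flips_inj : injective flips.
    move=> [y x] [y' x'] [yE]; rewrite -yE => xE.
    by rewrite -(flipK (free y) x) xE flipK yE.
  (* Accepted even instances are sent by [flips] to accepted odd ones, except those with blocked
     shifts, which are counted separately. *)
  apply: (@leq_trans #|(W :|: [set flips q | q in finset.setX [set y | blocked y] E])%SET|).
    rewrite -(card_imset _ flips_inj); apply: subset_leq_card.
    apply/fintype.subsetP => _ /imsetP [[y x] + ->].
    rewrite 2!inE /= => /andP [/andP [_ xE] run_x].
    apply/setUP; have [y_blocked|y_free] := boolP (blocked y); [right|left].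
      by apply: imset_f; rewrite !inE /= y_blocked; move: xE; rewrite inE.
    rewrite 2!inE /= !inE /= run_flip // run_x andbT.
    by apply/forallP => i; rewrite block_parity_flip; move: xE; rewrite inE => /forallP.
  apply: leq_trans (leq_card_setU _ _) _; rewrite leq_add2l card_imset // cardsX.
  rewrite leq_mul2r; apply/orP; right.
  apply: leq_trans (card_blocked _) _; rewrite leq_mul2l leq_exp2r //.
  exact: T_cost tT.
have E_gt0 : (0 < #|E|)%N.
  apply/card_gt0P; exists [ffun=> false]; rewrite inE; apply/forallP => i.
  by rewrite /block_parity big1 // => l _; rewrite ffunE.
rewrite !mulnA leq_pmul2r // card_ffun card_prod !card_ord => YM.
have : ((4 * k) ^ h.+1 <= 3 * m.+1 * k ^ h.+1)%N.
  by apply: leq_trans YM; rewrite leq_exp2r.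
have k_gt0 : (0 < k ^ h.+1)%N.
  by rewrite lt0n; apply/eqP => k0; move: YM; rewrite k0 muln0 leqn0 expn_eq0.
by rewrite expnMn leq_pmul2r // leqNgt h_large.
Qed.

(** * Upper bounds *)

Lemma ex_least (P : nat -> Prop) (n : nat) : P n ->
  exists q, [/\ P q, (q <= n)%N & forall k, P k -> (q <= k)%N].
Proof.
move=> Pn; have exP : exists k, `[< P k >] by exists n; apply/asboolP.
case: (ex_minnP exP) => q /asboolP Pq min_q.
by exists q; split=> [||k Pk] //; apply: min_q; apply/asboolP.
Qed.

Lemma eps_far_self (R : realType) (P : graph_property) (eps : R) (N : nat) (G H : graph N) :
  0 < eps -> (0 < N)%N -> P N H -> gdist G H = 0%N -> ~ eps_far P eps G.
Proof.
move=> eps_gt0 N_gt0 PH d0 /(_ H PH); rewrite d0 leNgt mulr_gt0 //.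
by rewrite ltr0n expn_gt0 N_gt0.
Qed.

(** Acceptance means consistency with some member of the property. On [N] different from [N0]
    nothing is queried, and the answer is positive exactly when [N] is positive. *)
Definition query_all (L N0 N : nat) : natest N :=
  let qs := if N == N0 then enum {: 'I_N * 'I_N} else [::] in
  NATest qs (fun bs => `[< exists2 H : graph N, no_component L N0 H &
                             [seq adj H p.1 p.2 | p <- qs] = bs >]).

Lemma nonadaptive_upper (R : realType) (L N0 : nat) (eps : R) : 0 < eps ->
  nonadaptive_tester (no_component L N0) eps (N0 ^ 2).
Proof.
move=> eps_gt0; exists (fun N => [:: (1, query_all L N0 N)]).
split=> [N|]; first by split=> [x [<-|] //=|]; rewrite ?ler01 // big_seq1.
split=> [N x [<-|] //|].
  rewrite /na_cost /=; case: (eqVneq N N0) => [<-|] //.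
  by rewrite -cardE card_prod card_ord.
split=> N G; rewrite /acc_prob big_seq1 mul1r /na_run.
  move=> PG; rewrite (_ : na_decide _ _ = true); last by apply/asboolP; exists G.
  by rewrite /=; lra.
move=> farG; rewrite (_ : na_decide _ _ = false) ?subr0; first by rewrite /=; lra.
apply/asboolPn => -[H PH]; rewrite /=; have [N_gt0 _] := PH.
case: (eqVneq N N0) => [_|NN0 _].
  move/eq_in_map => HG; apply: eps_far_self PH _ farG => //.
  apply/eqP; rewrite cards_eq0; apply/eqP/setP => p; rewrite !inE.
  by rewrite (HG p (mem_enum _ _)) eqxx andbF.
apply: (eps_far_self (P := no_component L N0) (H := G)) farG => //; last exact: gdistxx.
by split=> // NE; rewrite NE eqxx in NN0.
Qed.

(** The induction rests on [(1 - x) * (1 + (n + 1) * x) <= 1 + n * x]. It bounds the probability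
    that [n] samples all miss a set of density [x]. *)
Lemma onem_expr_le (R : realType) (x : R) (n : nat) : 0 <= x <= 1 ->
  (1 - x) ^+ n * (1 + n%:R * x) <= 1.
Proof.
move=> /andP [x_ge0 x_le1]; elim: n => [|n IHn]; first by rewrite expr0; lra.
apply: le_trans IHn; rewrite exprSr -mulrA ler_wpM2l ?exprn_ge0 ?subr_ge0 //.
rewrite -natr1; have := mulr_ge0 (ler0n R n) (sqr_ge0 x); have := sqr_ge0 x; nra.
Qed.

Definition sampler (R : realType) (L N0 n N : nat) : seq (R * dtree N) :=
  if N == 0%N then [:: (1, Leaf N false)]
  else if N == N0 then
    [seq ((#|{ffun 'I_n -> 'I_N}|%:R)^-1, sample_tree L (codom f)) | f : {ffun 'I_n -> 'I_N}]
  else [:: (1, Leaf N true)].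

Lemma In_map (A B : Type) (f : A -> B) (s : seq A) x :
  Stdlib.Lists.List.In x (map f s) -> exists y, x = f y.
Proof. by elim: s => //= a s IHs [<-|/IHs //]; exists a. Qed.

Lemma acc_prob_sampler (R : realType) (L n N : nat) (G : graph N) : (0 < N)%N ->
  acc_prob (fun t => dt_run t (adj G)) (sampler R L N n N) =
  (1 - #|component_size_set L G|%:R / N%:R) ^+ n.
Proof.
move=> N_gt0; have N_neq0 : N%:R != 0 :> R by rewrite pnatr_eq0 -lt0n.
rewrite /sampler eqxx -(negbK (N == 0%N)) -lt0n N_gt0 /= /acc_prob big_map big_enum /=.
rewrite -mulr_sumr -natr_sum.
have -> : (\sum_(f : {ffun 'I_n -> 'I_N}) dt_run (sample_tree L (codom f)) (adj G) =
    (N - #|component_size_set L G|) ^ n)%N.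
  have -> : (N - #|component_size_set L G| = #|~: component_size_set L G|%SET)%N.
    by rewrite [RHS]cardsCs finset.setCK card_ord.
  rewrite -[X in (_ ^ X)%N](card_ord n) -card_ffun_on.
  rewrite -sum1_card [RHS]big_mkcond /=; apply: eq_bigr => f _.
  rewrite dt_run_sample_tree (_ : all _ _ = (f \in ffun_on (~: component_size_set L G)%SET)).
    by case: (f \in _).
  apply/allP/ffun_onP => [good i|good _ /codomP [i ->]].
    by have := good _ (codom_f f i); rewrite !inE.
  by have := good i; rewrite !inE.
rewrite card_ffun !card_ord !natrX -exprVn -exprMn natrB; last first.
  by rewrite -[X in (_ <= X)%N](card_ord N) max_card.
by congr (_ ^+ _); field.
Qed.

(** Members are never rejected. In a far graph the bad vertices have density at least [1 / w], since
    isolating them costs at most [L] edits each; then [3 * w] samples all miss them with probability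
    at most 1/4. *)
Lemma adaptive_upper (R : realType) (L N0 w : nat) (eps : R) :
  (1 < L)%N -> 0 < eps -> (N0 * L)%:R <= w%:R * (eps * (N0 ^ 2)%:R) ->
  adaptive_tester (no_component L N0) eps (3 * w * (L * N0)).
Proof.
move=> L_gt1 eps_gt0 w_large; exists (sampler R L N0 (3 * w)).
split=> [N|].
  rewrite /sampler; case: (eqVneq N 0%N) => [_|N_neq0].
    by split=> [x [<-|] //=|]; rewrite ?ler01 // big_seq1.
  case: (eqVneq N N0) => [_|_]; last first.
    by split=> [x [<-|] //=|]; rewrite ?ler01 // big_seq1.
  split=> [x xD|]; first by have [f ->] := In_map xD; rewrite /= invr_ge0 ler0n.
  rewrite big_map big_enum /= sumr_const -[LHS]mulr_natl mulfV //.
  by rewrite pnatr_eq0 card_ffun !card_ord expn_eq0 negb_and N_neq0.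
split=> [N G x|].
  rewrite /sampler; case: (eqVneq N 0%N) => [_ [<-|] //|_].
  case: (eqVneq N N0) => [<- xD|_ [<-|] //]; have [f ->] := In_map xD.
  by apply: leq_trans (dt_cost_sample_tree _ _ _) _; rewrite size_codom card_ord.
split=> N G.
  move=> [N_gt0 PG]; have [NN0|NN0] := eqVneq N N0; last first.
    rewrite /sampler (negbTE NN0) -(negbK (N == 0%N)) -lt0n N_gt0 /= /acc_prob big_seq1 /=.
    by lra.
  rewrite -NN0 acc_prob_sampler // (_ : component_size_set L G = finset.set0).
    by rewrite cards0 mul0r subr0 expr1n; lra.
  by apply/setP => v; rewrite !inE (negbTE (PG NN0 v)).
move=> farG; have [N0E|N_gt0] := posnP N.
  by rewrite /sampler (introT eqP N0E) /acc_prob big_seq1 /= mulr0 subr0; lra.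
have [NN0|NN0] := eqVneq N N0; last first.
  exfalso; apply: (eps_far_self (P := no_component L N0) (H := G)) farG => //; last exact: gdistxx.
  by split=> // NE; rewrite NE eqxx in NN0.
rewrite -NN0 acc_prob_sampler //.
set b := #|component_size_set L G|.
have b_large : N%:R <= w%:R * b%:R :> R.
  rewrite -(ler_pM2r (x := L%:R)); last by rewrite ltr0n ltnW.
  rewrite -mulrA -!natrM; rewrite -NN0 in w_large; apply: le_trans w_large _.
  rewrite natrM ler_wpM2l ?ler0n //.
  apply: le_trans (farG _ (isolate_no_component N0 G L_gt1 N_gt0)) _.
  by rewrite ler_nat gdist_isolate.
have NR_gt0 : 0 < N%:R :> R by rewrite ltr0n.
have b_le : b%:R / N%:R <= 1 :> R.
  by rewrite ler_pdivrMr // mul1r ler_nat -[X in (_ <= X)%N](card_ord N) max_card.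
have b_ge0 : 0 <= b%:R / N%:R :> R by rewrite divr_ge0.
have wb : 1 <= w%:R * (b%:R / N%:R) :> R by rewrite mulrA ler_pdivlMr // mul1r.
have := @onem_expr_le R (b%:R / N%:R) (3 * w); rewrite b_ge0 b_le natrM => /(_ isT).
have : 0 <= (1 - b%:R / N%:R : R) ^+ (3 * w) by rewrite exprn_ge0 ?subr_ge0.
set z := _ ^+ _; set y := w%:R * _ in wb *; rewrite -mulrA -/y; nra.
Qed.

(** * Choice of parameters *)

(** The number of blocks is [w ^ t.+1], the bad component size is [4 * h.+1], and [t.+2] stands for
    the exponent of the theorem. *)
Lemma query_complexities (R : realType) (t w h : nat) :
  (32 * h.+1 ^ 2 <= w)%N -> (3 * w ^ t.+1 < 4 ^ h.+1)%N ->
  exists P : graph_property, iso_closed P /\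
  exists q Q : nat,
    [/\ adaptive_qc P ((w ^ t.+2)%:R^-1 : R) q, nonadaptive_qc P ((w ^ t.+2)%:R^-1 : R) Q &
    [/\ w ^ t.+2 <= 96 * h.+1 ^ 2 * q, q <= 48 * h.+1 ^ 2 * w ^ t.+2,
        (w ^ t.+1) ^ 2 <= 4 * Q & Q <= 16 * h.+1 ^ 2 * (w ^ t.+1) ^ 2]%N].
Proof.
move=> h_small h_large; have w_gt0 : (0 < w)%N by apply: leq_trans h_small.
set eps : R := _^-1; pose m := (w ^ t.+1).-1.
have mE : m.+1 = (w ^ t.+1)%N by rewrite /m prednK // expn_gt0 w_gt0.
have wR_neq0 : w%:R != 0 :> R by rewrite pnatr_eq0 -lt0n.
have eps_gt0 : 0 < eps by rewrite invr_gt0 ltr0n expn_gt0 w_gt0.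
have epsN : eps * (#|{: slot m h}| ^ 2)%:R = (16 * h.+1 ^ 2 * w ^ t)%:R.
  rewrite card_slot mE /eps !natrX !natrM !natrX [w%:R ^+ t.+2]exprS [w%:R ^+ t.+1]exprS.
  by field; rewrite expf_neq0 // wR_neq0.
(* The size of [A] is exactly [2 * eps * N ^ 2] for [N] vertices, the fewest odd blocks for which
   farness is guaranteed by [gdist_ladder_odd]. *)
pose A := [set i : 'I_m.+1 | (i < 32 * h.+1 ^ 2 * w ^ t)%N]%SET.
have A_le : (32 * h.+1 ^ 2 * w ^ t <= m.+1)%N.
  by rewrite mE [(w ^ t.+1)%N]expnS leq_mul2r h_small orbT.
have cardA : #|A| = (32 * h.+1 ^ 2 * w ^ t)%N.
  have widen_inj : injective (widen_ord A_le) by move=> i j /(congr1 val) /= ij; apply: val_inj.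
  rewrite -[RHS]card_ord -(card_imset _ widen_inj); apply: eq_card => i.
  rewrite inE; apply/idP/imsetP => [i_lt|[j _ ->] //=].
  by exists (Ordinal i_lt) => //; apply: val_inj.
set P := no_component (4 * h.+1) #|{: slot m h}|.
exists P; split; first exact: no_component_iso.
(* The density condition holds with equality: [N * L] is [w * eps * N ^ 2]. *)
have up_q : adaptive_tester P eps (3 * w * (4 * h.+1 * #|{: slot m h}|)).
  apply: adaptive_upper => //; first by lia.
  rewrite epsN card_slot mE -natrM ler_nat [(w ^ t.+1)%N]expnS; lia.
have [q [test_q q_le q_min]] := ex_least up_q.
have [Q [test_Q Q_le Q_min]] := ex_least (nonadaptive_upper (4 * h.+1) #|{: slot m h}| eps_gt0).
exists q, Q; split=> //; split.
- have lower : (m.+1 ^ 2 <= 3 * (q * #|A|))%N.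
    by apply: adaptive_lower test_q; rewrite epsN -natrM ler_nat cardA; lia.
  rewrite cardA mE in lower.
  rewrite -(leq_pmul2r (m := w ^ t)) ?expn_gt0 ?w_gt0 //.
  have -> : (w ^ t.+2 * w ^ t = (w ^ t.+1) ^ 2)%N by rewrite -expnD -expnM; congr expn; lia.
  by apply: leq_trans lower _; lia.
- apply: leq_trans q_le _; rewrite card_slot mE [(w ^ t.+2)%N]expnS; lia.
- rewrite -mE ltnW //; apply: nonadaptive_lower test_Q; last by rewrite mE.
  rewrite epsN -natrM ler_nat; apply: leq_trans A_le; lia.
- by apply: leq_trans Q_le _; rewrite card_slot mE !expnMn; lia.
Qed.

(** Both sides are compared with [u.+1 ^ 4], using [32 <= 6 ^ 2]. *)
Lemma exp2_ge_square (t u : nat) : (6 * (4 * t).+1 <= u)%N ->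
  (32 * (4 * u * t).+1 ^ 2 <= 2 ^ (4 * u))%N.
Proof.
move=> u_large; apply: (@leq_trans (u.+1 ^ 4)); last first.
  by rewrite [(4 * u)%N]mulnC expnM leq_exp2r // ltn_expl.
have step : (6 * (4 * u * t).+1 <= u.+1 ^ 2)%N by nia.
have : ((6 * (4 * u * t).+1) ^ 2 <= (u.+1 ^ 2) ^ 2)%N by rewrite leq_exp2r.
by rewrite -expnM expnMn; apply: leq_trans; rewrite leq_mul2r orbT.
Qed.

(** An exponent of at most 2 costs at most [b ^+ 2], so the constants are uniform in [t]. *)
Lemma powR_le_scale (R : realType) (b x y p : R) :
  1 <= b -> 0 <= x -> 0 <= y -> 0 <= p <= 2 -> x <= b * y -> x `^ p <= b ^+ 2 * y `^ p.
Proof.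
move=> b_ge1 x_ge0 y_ge0 /andP [p_ge0 p_le2] xby; have b_ge0 : 0 <= b by lra.
apply: (@le_trans _ _ ((b * y) `^ p)).
  by apply: ge0_ler_powR; rewrite ?nnegrE ?mulr_ge0.
rewrite powRM // ler_wpM2r ?powR_ge0 // -powR_mulrn //.
exact: ler_powR.
Qed.

(** Here [n] is the binary logarithm of the inverse of epsilon. This converts powers of [h.+1] into
    powers of [logfac]. *)
Lemma logfac_exp2 (R : realType) (n : nat) :
  n.+1%:R <= (1 + (ln 2)^-1) * logfac ((2 ^ n)%:R^-1 : R).
Proof.
have ln2_gt0 : 0 < ln 2 :> R by rewrite ln_gt0 // ltr1n.
have nln2 : n%:R * ln 2 <= ln (1 + (2 ^ n)%:R) :> R.
  rewrite mulr_natl -lnXn // -natrX ler_ln ?posrE ?ltr_wpDr ?ltr0n ?expn_gt0 //.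
  by rewrite lerDr.
rewrite /logfac invrK; set l := ln (1 + _) in nln2 *.
have il_ge0 : 0 < (ln 2 : R)^-1 by rewrite invr_gt0.
have : n%:R <= (ln 2)^-1 * l.
  by rewrite mulrC ler_pdivlMr.
have : 0 <= l by apply: le_trans nln2; rewrite mulr_ge0 // ltW.
rewrite -natr1; nra.
Qed.

Theorem theorem1 (R : realType) (t : nat) (ht : (8 <= t)%N) :
  exists (c C : R) (a : nat), 0 < c /\ 0 < C /\
  forall eps0 : R, 0 < eps0 ->
  exists eps : R, 0 < eps /\ eps < eps0 /\
  exists P : graph_property, iso_closed P /\
  exists q Q : nat,
    adaptive_qc P eps q /\ nonadaptive_qc P eps Q /\
    c * eps^-1 / logfac eps ^+ a <= q%:R /\
    q%:R <= C * eps^-1 * logfac eps ^+ a /\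
    c * (q%:R `^ (2 - 2 / t%:R)) / logfac eps ^+ a <= Q%:R /\
    Q%:R <= C * (q%:R `^ (2 - 2 / t%:R)) * logfac eps ^+ a.
Proof.
(* The worst of the four bounds, the last one, has factor [16 * H ^+ 2 * (96 * H ^+ 2) ^+ 2], which
   is [384 ^+ 2 * H ^+ 6]. *)
pose K : R := 1 + (ln 2)^-1; pose C : R := 384 ^+ 2 * K ^+ 6.
have ln2_gt0 : 0 < ln 2 :> R by rewrite ln_gt0 // ltr1n.
have K_ge1 : 1 <= K by rewrite lerDl invr_ge0 ltW.
have C_gt0 : 0 < C by rewrite mulr_gt0 // exprn_gt0 //; lra.
exists C^-1, C, 6; split; first by rewrite invr_gt0.
split=> // eps0 eps0_gt0.
(* The first argument makes [w] dominate [h.+1 ^ 2]; the second makes epsilon, which is [2 ^- h],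
   smaller than [eps0]. *)
pose u := maxn (6 * (4 * t).+1) (Num.bound eps0^-1).
pose w := (2 ^ (4 * u))%N; pose h := (4 * u * t)%N.
have wt : (w ^ t = 2 ^ h)%N by rewrite /w /h -expnM.
case: t ht @u @w @h wt => [//|[//|t]] _ u w h wt.
have h_small : (32 * h.+1 ^ 2 <= w)%N by apply: exp2_ge_square; rewrite leq_maxl.
have w_gt0 : (0 < w)%N by rewrite expn_gt0.
have h_large : (3 * w ^ t.+1 < 4 ^ h.+1)%N.
  have : (w ^ t.+1 <= 2 ^ h)%N by rewrite -wt leq_pexp2l.
  rewrite (_ : 4 ^ h.+1 = 4 * (2 ^ h * 2 ^ h))%N; last by rewrite expnS -expnMn.
  have := expn_gt0 2 h; nia.
have [P [P_iso [q [Q [qP QP [lo_q up_q lo_Q up_Q]]]]]] := query_complexities R h_small h_large.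
set eps : R := _^-1 in qP QP.
have E_gt0 : 0 < (w ^ t.+2)%:R :> R by rewrite ltr0n expn_gt0 w_gt0.
exists eps; split; first by rewrite invr_gt0.
split.
  rewrite -[eps0]invrK ltf_pV2 ?posrE ?invr_gt0 //.
  apply: lt_le_trans (archi_boundP _) _; first by rewrite invr_ge0 ltW.
  rewrite ler_nat wt; apply: leq_trans (ltnW (ltn_expl h (ltnSn 1))).
  apply: (@leq_trans u); first by rewrite leq_maxr.
  by rewrite /h; lia.
exists P; split=> //; exists q, Q; split=> //; split=> //.
set T : R := t.+2%:R; have T_ge2 : 2 <= T by rewrite ler_nat.
have p_bounds : 0 <= 2 - 2 / T <= 2.
  by rewrite subr_ge0 ler_pdivrMr ?gerBl ?divr_ge0 /=; lra.
(* Since [T * (2 - 2 / T)] is [2 * (T - 1)], the power is exactly the square of the number of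
   blocks. *)
have E_powR : (w ^ t.+2)%:R `^ (2 - 2 / T) = ((w ^ t.+1) ^ 2)%:R :> R.
  rewrite natrX -powR_mulrn // -powRrM -expnM natrX -powR_mulrn //.
  congr (_ `^ _); rewrite natrM -/T mulrBr mulrCA mulfV; last by lra.
  by rewrite /T -[t.+2]addn1 natrD; ring.
have H_ge1 : 1 <= h.+1%:R :> R by rewrite ler1n.
have := logfac_exp2 R h; rewrite -wt -/eps -/K.
set H := h.+1%:R in H_ge1 *; set l := logfac eps => H_le.
have l_gt0 : 0 < l by nra.
have powH n : H ^+ n <= K ^+ n * l ^+ n.
  by rewrite -exprMn; apply: lerXn2r; rewrite ?nnegrE //; nra.
have Hmono n : (n <= 6)%N -> H ^+ n <= H ^+ 6 by move=> n6; apply: ler_weXn2l.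
have H6 := powH 6.
(* With [lower], this reduces each of the four bounds to one with a numerical factor and at most six
   powers of [H]. *)
have scaled (D x y : R) n : (n <= 6)%N -> 0 <= D <= 384 ^+ 2 -> 0 <= y -> x <= D * H ^+ n * y ->
    x <= C * l ^+ 6 * y.
  move=> n6 /andP [D_ge0 D_le] y_ge0 xy; apply: le_trans xy _; rewrite ler_wpM2r // /C -mulrA.
  apply: (@le_trans _ _ (384 ^+ 2 * H ^+ n)); first by rewrite ler_wpM2r // exprn_ge0 //; lra.
  by rewrite ler_wpM2l // (le_trans (Hmono n n6)).
have lower x y : x <= C * l ^+ 6 * y -> C^-1 * x / l ^+ 6 <= y.
  move=> xy; rewrite ler_pdivrMr ?exprn_gt0 // mulrC ler_pdivrMr //.
  by apply: le_trans xy _; rewrite mulrC mulrA mulrAC.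
have lo_qR : (w ^ t.+2)%:R <= 96 * H ^+ 2 * q%:R :> R by rewrite -natrX -!natrM ler_nat.
have up_qR : q%:R <= 48 * H ^+ 2 * (w ^ t.+2)%:R :> R by rewrite -natrX -!natrM ler_nat.
have lo_QR : ((w ^ t.+1) ^ 2)%:R <= 4 * Q%:R :> R by rewrite -natrM ler_nat.
have up_QR : Q%:R <= 16 * H ^+ 2 * ((w ^ t.+1) ^ 2)%:R :> R by rewrite -[H ^+ 2]natrX -!natrM ler_nat.
have H2_ge1 : 1 <= H ^+ 2 by rewrite exprn_ege1.
have qp_le : q%:R `^ (2 - 2 / T) <= (48 * H ^+ 2) ^+ 2 * ((w ^ t.+1) ^ 2)%:R.
  by rewrite -E_powR; apply: powR_le_scale => //; lra.
have qp_ge : ((w ^ t.+1) ^ 2)%:R <= (96 * H ^+ 2) ^+ 2 * q%:R `^ (2 - 2 / T).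
  by rewrite -E_powR; apply: powR_le_scale => //; lra.
rewrite invrK; split; first by apply: lower; apply: scaled lo_qR; rewrite ?ler0n //; lra.
split; first by rewrite mulrAC; apply: scaled up_qR; rewrite ?ler0n //; lra.
split.
  apply/lower/(scaled (96 ^+ 2) _ _ 4) => //; first by lra.
  apply: le_trans qp_le _.
  have -> : 96 ^+ 2 * H ^+ 4 * Q%:R = (48 * H ^+ 2) ^+ 2 * (4 * Q%:R) by ring.
  by rewrite ler_wpM2l // exprn_ge0 //; lra.
rewrite mulrAC; apply: (scaled (384 ^+ 2) _ _ 6%N) => //; first by lra.
apply: le_trans up_QR _.
have -> : 384 ^+ 2 * H ^+ 6 * q%:R `^ (2 - 2 / T) =
    16 * H ^+ 2 * ((96 * H ^+ 2) ^+ 2 * q%:R `^ (2 - 2 / T)) by ring.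
by rewrite ler_wpM2l //; lra.
Qed.
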